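(* Let $f(x)=c^{\mathsf T}x$ and suppose the feasible set $\Omega$ is bounded. Let $\rho>\bar\rho:=\max\{\rho_J: J\in\mathcal P,\ \Omega_J\ne\varnothing\}$, where the exact-penalty thresholds $\rho_J$ are as in the context, and let $\{x^k\}_{k\in\mathbb N}$ be generated by the randomized penalty-objective simplex search algorithm (RPSA) described in the context. Let $x^\infty:=x^N$, where $N$ is a finite, realization-dependent index such that $x^k=x^N$ for all $k\ge N$ (such an index exists on every realization). Then, almost surely, $x^\infty$ is B-stationary for $\min_{x\in\Omega}c^{\mathsf T}x$, and hence a local minimizer of this problem.
   Context: Let $n_0\ge0$, $m\ge1$ be integers, $n=n_0+2m$, and write $x=(x_0,x_1,x_2)\in\mathbb R^{n_0}\times\mathbb R^m\times\mathbb R^m$ for $x\in\mathbb R^n$. Fix matrices $A,B$ and vectors $a,b$ of compatible dimensions; vector inequalities are componentwise, $[m]=\{1,\dots,m\}$, $\mathbb N=\{0,1,\dots\}$. The feasible set is $\Omega=\{x\in\mathbb R^n: Ax-a=0,\ Bx-b\ge0,\ x_1\ge0,\ x_2\ge0,\ x_{1,i}x_{2,i}=0\ \forall i\in[m]\}$. The relaxed polyhedron is $\mathcal C=\{x\in\mathbb R^n: Ax-a=0,\ Bx-b\ge0,\ x_1\ge0,\ x_2\ge0\}$, and $\operatorname{ext}\mathcal C$ is its set of extreme points (vertices). Labels and branches: $\mathcal P$ is the set of the $2^m$ ordered pairs $J=(D_1,D_2)$ with $D_1\cup D_2=[m]$, $D_1\cap D_2=\varnothing$. For $J=(D_1,D_2)\in\mathcal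 P$, $\Omega_J=\{x: Ax-a=0,\ Bx-b\ge0,\ x_{1,i}=0,\,x_{2,i}\ge0\ (i\in D_1),\ x_{1,i}\ge0,\,x_{2,i}=0\ (i\in D_2)\}$, so $\Omega=\bigcup_{J}\Omega_J$. The branch residual is $\psi_J(x)=\sum_{i\in D_1}x_{1,i}+\sum_{i\in D_2}x_{2,i}$. For $x\in\Omega$, $\mathcal P(x)=\{J\in\mathcal P: x\in\Omega_J\}$, $\mathcal I_{00}(x)=\{i: x_{1,i}=x_{2,i}=0\}$, $\mathcal I_{0+}(x)=\{i: x_{1,i}=0,\ x_{2,i}>0\}$. Thresholds: for each $J$ with $\Omega_J\ne\varnothing$ (and $\min_{\Omega_J}c^{\mathsf T}x$ finite), $\rho_J\ge0$ is a fixed finite number such that for every $\rho>\rho_J$, $\operatorname{argmin}_{x\in\mathcal C}\{c^{\mathsf T}x+\rho\psi_J(x)\}=\operatorname{argmin}_{x\in\Omega_J}c^{\mathsf T}x$ (such a number exists). Tangent cone of $S\subseteq\mathbb R^n$ at $\bar x\in S$: $T_S(\bar x)=\{d:\exists\,t_\ell\downarrow0,\ d^\ell\to d,\ \bar x+t_\ell d^\ell\in S\}$. A point $\bar x\in\Omega$ is B-stationary for $\min_\Omega f$ if $\nabla f(\bar x)^{\mathsf T}d\ge0$ for all $d\in T_\Omega(\bar x)$. RPSA: input a feasible $x^0\in\Omega$ and $\rho>\bar\rho$. Initialization: if $x^0\notin\operatorname{ext}\mathcal C$, choose any $J^{\rm init}\in\mathcal P(x^0)$ and replace $x^0$ by an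 optimal vertex of $\min\{c^{\mathsf T}x:x\in\Omega_{J^{\rm init}}\}$; store a primal-feasible basis of $\mathcal C$ representing $x^0$. For $k=0,1,2,\dots$: sample $\xi_i^k\in\{0,1\}$ conditionally independently and uniformly for $i\in\mathcal I_{00}(x^k)$; put $D_1^k=\mathcal I_{0+}(x^k)\cup\{i\in\mathcal I_{00}(x^k):\xi_i^k=1\}$, $D_2^k=[m]\setminus D_1^k$, $J^k=(D_1^k,D_2^k)\in\mathcal P(x^k)$, and $\phi_k(u)=c^{\mathsf T}u+\rho\psi_{J^k}(u)$. Run primal-simplex pivots for $\min_{u\in\mathcal C}\phi_k(u)$ from the stored basis of $x^k$ with a finitely terminating pivot rule, i.e. visit a finite sequence of vertices of $\mathcal C$ starting at $x^k$ which, if not interrupted, ends at an optimal vertex of $\min_{\mathcal C}\phi_k$; stop at the first visited vertex $z$ with $\phi_k(z)<\phi_k(x^k)$ and $\psi_{J^k}(z)=0$ (an acceptable vertex), or else at penalty-LP optimality. If an acceptable vertex $z$ is found set $x^{k+1}=z$ and store its basis; otherwise set $x^{k+1}=x^k$ and retain the stored basis. Probability: all random quantities live on a probability space $(\Xi,\mathcal G,\mathbb P)$ with a filtration $\{\mathcal F_k\}$ representing the information available immediately before the draw at iteration $k$; $x^k$ is $\mathcal F_k$-measurable, $J^k$ is $\mathcal F_{k+1}$-measurable, and $\mathbb P(J^k=J\mid\mathcal F_k)=\mathbf 1_{\{J\in\mathcal P(x^k)\}}/|\mathcal P(x^k)|$ for every $J\in\mathcal P$. *)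

(* Defs.v *)
From mathcomp Require Import all_boot all_order all_algebra.
From mathcomp Require Import all_classical all_reals all_analysis.

Set Implicit Arguments.
Unset Strict Implicit.
Unset Printing Implicit Defensive.

Import Order.TTheory GRing.Theory Num.Theory numFieldNormedType.Exports.
Local Open Scope classical_set_scope.
Local Open Scope ring_scope.

Section Optimization.
Variables (R : realType) (n : nat).
Implicit Types (S : set 'cV[R]_n) (f : 'cV[R]_n -> R) (x d : 'cV[R]_n).

Definition dot (u v : 'cV[R]_n) : R := \sum_(i < n) u i 0 * v i 0.

Definition argmin S f : set 'cV[R]_n :=
  [set x | S x /\ forall y, S y -> f x <= f y].

Definition extreme_points S : set 'cV[R]_n :=
  [set x | S x /\ forall y z (t : R), S y -> S z -> 0 < t < 1 ->
                  x = t *: y + (1 - t) *: z -> y = x /\ z = x].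

Definition gradient f x : 'cV[R]_n := \col_i 'D_(delta_mx i 0) f x.

(* [t] decreases to 0 in the usual sense for tangent cones: it is positive and
   tends to 0, with no monotonicity required. *)
Definition tangent_cone S x : set 'cV[R]_n :=
  [set d | exists (t : nat -> R) (dl : nat -> 'cV[R]_n),
     [/\ forall l, 0 < t l,
         t l @[l --> \oo] --> (0 : R),
         dl l @[l --> \oo] --> d
       & forall l, S (x + t l *: dl l)]].

Definition B_stationary f S x : Prop :=
  S x /\ forall d, tangent_cone S x d -> 0 <= dot (gradient f x) d.

Definition local_minimizer f S x : Prop :=
  S x /\ \forall y \near x, S y -> f x <= f y.

End Optimization.

(* Linear constraints of the program, in the variable
   x = (x_0, x_1, x_2) : 'cV_(n0 + (m + m)). *)
Record lpcc (R : realType) (n0 m p q : nat) := LPCC {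
  eq_mx : 'M[R]_(p, n0 + (m + m));
  eq_rhs : 'cV[R]_p;
  ineq_mx : 'M[R]_(q, n0 + (m + m));
  ineq_rhs : 'cV[R]_q }.

Definition label (m : nat) : finType := ({set 'I_m} * {set 'I_m})%type.

Definition labels (m : nat) : {set label m} :=
  [set J : label m | (J.1 :|: J.2 == [set: 'I_m]%SET)
                     && (J.1 :&: J.2 == finset.set0)].

Section Feasibility.
Variables (R : realType) (n0 m p q : nat) (L : lpcc R n0 m p q).
Implicit Types (x : 'cV[R]_(n0 + (m + m))) (J : label m).

Definition comp1 x (i : 'I_m) : R := x (rshift n0 (lshift m i)) 0.
Definition comp2 x (i : 'I_m) : R := x (rshift n0 (rshift m i)) 0.

Definition linear_feasible x : Prop :=
  eq_mx L *m x - eq_rhs L = 0 /\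
  forall i, 0 <= (ineq_mx L *m x - ineq_rhs L) i 0.

Definition relaxed : set 'cV[R]_(n0 + (m + m)) :=
  [set x | linear_feasible x /\ forall i, 0 <= comp1 x i /\ 0 <= comp2 x i].

Definition feasible : set 'cV[R]_(n0 + (m + m)) :=
  [set x | [/\ linear_feasible x,
               forall i, 0 <= comp1 x i /\ 0 <= comp2 x i
             & forall i, comp1 x i * comp2 x i = 0]].

Definition branch J : set 'cV[R]_(n0 + (m + m)) :=
  [set x | [/\ linear_feasible x,
               forall i, i \in J.1 -> comp1 x i = 0 /\ 0 <= comp2 x i
             & forall i, i \in J.2 -> 0 <= comp1 x i /\ comp2 x i = 0]].

Definition residual J x : R :=
  \sum_(i in J.1) comp1 x i + \sum_(i in J.2) comp2 x i.

Definition active_labels x : {set label m} :=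
  [set J in labels m | `[< branch J x >]].

Definition I00 x : {set 'I_m} := [set i | (comp1 x i == 0) && (comp2 x i == 0)].
Definition I0p x : {set 'I_m} := [set i | (comp1 x i == 0) && (0 < comp2 x i)].

Definition penalized (c : 'cV[R]_(n0 + (m + m))) (rho : R) J x : R :=
  dot c x + rho * residual J x.

Definition exact_threshold (c : 'cV[R]_(n0 + (m + m))) J (r : R) : Prop :=
  0 <= r /\ forall rho, r < rho ->
    argmin relaxed (penalized c rho J) = argmin (branch J) (dot c).

(* Thresholds are nonnegative, so the default value 0 does not affect the
   maximum as soon as some branch is nonempty. *)
Definition max_threshold (rhoJ : label m -> R) : R :=
  \big[Num.max/0]_(J in labels m | `[< branch J !=set0 >]) rhoJ J.

(* All constraints of the relaxed polyhedron, stacked: the rows of the two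
   linear systems, followed by the sign constraints on x_1 and x_2. *)
Definition all_mx : 'M[R]_(p + (q + (m + m)), n0 + (m + m)) :=
  col_mx (eq_mx L)
    (col_mx (ineq_mx L) (dsubmx (1%:M : 'M[R]_(n0 + (m + m))))).

Definition all_rhs : 'cV[R]_(p + (q + (m + m))) :=
  col_mx (eq_rhs L) (col_mx (ineq_rhs L) 0).

Definition basis_set : finType := {set 'I_(p + (q + (m + m)))}.

(* A basis is recorded by the constraints it makes tight (the equations and
   the nonbasic variables/slacks set to 0): as many linearly independent
   constraints as there are variables. *)
Definition feasible_basis (S : basis_set) x : Prop :=
  [/\ relaxed x,
      #|S| = (n0 + (m + m))%N,
      row_free (rowsub (enum_val : 'I_#|S| -> _) all_mx)
    & forall i, i \in S -> (all_mx *m x) i 0 = all_rhs i 0].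

End Feasibility.

Section RPSA.
Variables (R : realType) (n0 m p q : nat) (L : lpcc R n0 m p q).
Variables (c : 'cV[R]_(n0 + (m + m))) (rho : R).

(* The stored basis together with the current iterate. *)
Definition state : choiceType :=
  (basis_set m p q * 'cV[R]_(n0 + (m + m)))%type.

Definition drawn_label (x : 'cV[R]_(n0 + (m + m))) (s : {ffun 'I_m -> bool}) :
    label m :=
  let D1 := (I0p x :|: [set i in I00 x | s i])%SET in (D1, (~: D1)%SET).

Definition pivot (u v : state) : bool := #|u.1 :\: v.1| == 1%N.

(* [u :: s] is a complete (uninterrupted) run of primal simplex pivots for the
   minimization of [phi] over the relaxed polyhedron. *)
Definition simplex_run (phi : 'cV[R]_(n0 + (m + m)) -> R) (u : state)
    (s : seq state) : Prop :=
  [/\ path pivot u s,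
      forall v, v \in u :: s ->
        extreme_points (relaxed L) v.2 /\ feasible_basis L v.1 v.2
    & argmin (relaxed L) phi (last u s).2].

Definition acceptable (J : label m) (x z : 'cV[R]_(n0 + (m + m))) : bool :=
  (penalized c rho J z < penalized c rho J x) && (residual J z == 0).

(* The new state is the first acceptable vertex of the run, with its basis, or
   the current state if the run has none. *)
Definition rpsa_step (J : label m) (u v : state) : Prop :=
  exists2 s : seq state, simplex_run (penalized c rho J) u s &
    v = head u [seq w <- u :: s | acceptable J u.2 w.2].

Definition rpsa_init (xin : 'cV[R]_(n0 + (m + m))) (u : state) : Prop :=
  [/\ extreme_points (relaxed L) xin -> u.2 = xin,
      ~ extreme_points (relaxed L) xin ->
        exists2 J, J \in active_labels L xin &
          extreme_points (branch L J) u.2 /\ argmin (branch L J) (dot c) u.2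
    & feasible_basis L u.1 u.2].

Definition rpsa_realization (xin : 'cV[R]_(n0 + (m + m)))
    (st : nat -> state) (xi : nat -> {ffun 'I_m -> bool}) : Prop :=
  rpsa_init xin (st 0%N) /\
  forall k, rpsa_step (drawn_label (st k).2 (xi k)) (st k) (st k.+1).

End RPSA.

Section Sampling.
Context {R : realType} {d : measure_display} {Xi : measurableType d}.
Variable P : probability Xi R.

Definition filtration (F : nat -> set (set Xi)) : Prop :=
  forall k, [/\ sigma_algebra setT (F k), F k `<=` measurable
              & F k `<=` F k.+1].

Definition measurable_wrt (G : set (set Xi)) (g : Xi -> R) : Prop :=
  forall B : set R, measurable B -> G (g @^-1` B).

(* [g] is a version of the conditional probability of [E] given [G]. *)
Definition is_cond_prob (G : set (set Xi)) (E : set Xi) (g : Xi -> R) : Prop :=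
  measurable_wrt G g /\
  forall A, G A -> (\int[P]_(w in A) (g w)%:E)%E = P (A `&` E).

(* [x k] and [xi k] are the iterate and the coin flips at iteration k; only the
   flips of indices in [I00 (x k w)] are constrained and used. The joint law in
   the fourth field is conditional independence and uniformity of these flips;
   the last field is the law it induces on the drawn label. *)
Record rpsa_sampling (n0 m p q : nat) (L : lpcc R n0 m p q)
    (F : nat -> set (set Xi)) (x : nat -> Xi -> 'cV[R]_(n0 + (m + m)))
    (xi : nat -> Xi -> {ffun 'I_m -> bool}) : Prop := {
  sampling_filtration : filtration F;
  iterate_measurable : forall k i, measurable_wrt (F k) (fun w => x k w i 0);
  label_measurable : forall k (J : label m),
    F k.+1 [set w | drawn_label (x k w) (xi k w) = J];
  flips_law : forall k (s : {ffun 'I_m -> bool}),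
    is_cond_prob (F k)
      [set w | forall i, i \in I00 (x k w) -> xi k w i = s i]
      (fun w => 2^-1 ^+ #|I00 (x k w)|);
  label_law : forall k (J : label m), J \in labels m ->
    is_cond_prob (F k)
      [set w | drawn_label (x k w) (xi k w) = J]
      (fun w => (J \in active_labels L (x k w))%:R
                / #|active_labels L (x k w)|%:R) }.

End Sampling.

(* Main.v *)
(* Every move of the algorithm strictly decreases the linear cost among the
   finitely many points represented by a feasible basis, so the iterates settle
   at some x. If x were not optimal on a branch J active at x, then by exactness
   of the penalty drawing J would force a move; hence J is never drawn once the
   iterates have settled, although each draw selects it with the same positive
   conditional probability, and this has probability zero. Being optimal on all
   its active branches, which cover the feasible set near x, the point x is a
   local minimizer, and therefore B-stationary. *)

Require Import Defs.
From mathcomp Require Import all_boot all_order all_algebra.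
From mathcomp Require Import all_classical all_reals all_analysis.
Set Implicit Arguments.
Unset Strict Implicit.
Unset Printing Implicit Defensive.
Import Order.TTheory GRing.Theory Num.Theory numFieldNormedType.Exports.
Local Open Scope classical_set_scope.
Local Open Scope ring_scope.

(** * Linear objectives: gradient, stationarity and lower bounds *)

Section DotProduct.
Variables (R : realType) (n : nat) (c : 'cV[R]_n).
Implicit Types (S : set 'cV[R]_n) (x v : 'cV[R]_n).

Lemma dotDZr x (t : R) v : dot c (x + t *: v) = dot c x + t * dot c v.
Proof.
rewrite /dot mulr_sumr -big_split /=; apply: eq_bigr => i _.
by rewrite !mxE mulrDr mulrCA.
Qed.

Lemma dot_continuous : continuous (dot c).
Proof.
apply: (@continuous_big R 'I_n _ 0 xpredT (@add_continuous R)) => i _ x.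
by apply: cvgMl_tmp; [exact: nbhs_filter|exact: coord_continuous].
Qed.

Lemma gradient_dot x : gradient (dot c) x = c.
Proof.
apply/colP => i; rewrite mxE.
have -> : 'D_(delta_mx i 0) (dot c) x = dot c (delta_mx i 0).
  (* By linearity the difference quotient is constant for [h != 0]. *)
  apply: cvg_lim => //; apply: cvg_near_cst; near=> h.
  rewrite /= [X in dot c X]addrC dotDZr [X in X - _]addrC addrK.
  rewrite /GRing.scale /= mulrA mulVf ?mul1r //.
  by near: h; exact: nbhs_dnbhs_neq.
rewrite /dot (bigD1 i) //= big1 ?addr0 ?mxE ?eqxx ?mulr1 // => j ji.
by rewrite mxE (negbTE ji) mulr0.
Unshelve. all: by end_near. Qed.

(** Along [x + t l *: dl l] the cost changes by exactly [t l * dot c (dl l)]. Local minimality and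
    [0 < t l] make [dot c (dl l)] eventually nonnegative, and this passes to the limit. *)
Lemma local_minimizer_dot_B_stationary S x :
  local_minimizer (dot c) S x -> B_stationary (dot c) S x.
Proof.
move=> [Sx near_le]; split=> // v [t [dl [t_gt0 t0 dlv St]]].
rewrite gradient_dot.
have step_cvg : x + t l *: dl l @[l --> \oo] --> x.
  rewrite -[X in _ --> X]addr0 -[X in _ + X](scale0r v).
  by apply: cvgD; [exact: cvg_cst|exact: cvgZ].
have dot_cvg : dot c (dl l) @[l --> \oo] --> dot c v.
  exact: (cvg_comp _ _ dlv (@dot_continuous v)).
have dot_ge0 : \forall l \near \oo, 0 <= dot c (dl l).
  have near_l : \forall l \near \oo, S (x + t l *: dl l) ->
    dot c x <= dot c (x + t l *: dl l) by exact: step_cvg _ near_le.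
  apply: filterS near_l => l /(_ (St l)).
  by rewrite dotDZr lerDl pmulr_rge0.
have /cvg_lim <- // := dot_cvg.
by apply: limr_ge dot_ge0; apply/cvg_ex; exists (dot c v).
Qed.

Lemma bounded_set_dot_lbound S : bounded_set S -> has_lbound (dot c @` S).
Proof.
move=> [M [_ /(_ (M + 1))]]; rewrite ltrDl ltr01 => /(_ isT) SM.
(* The norm on vectors is the max norm, so every coordinate of a point of [S] is at most [M + 1] in
   absolute value. *)
exists (- \sum_(i < n) `|c i 0| * (M + 1)) => _ [x Sx <-].
rewrite lerNl; apply: le_trans (_ : `|dot c x| <= _).
  by rewrite -normrN ler_norm.
rewrite /dot; apply: le_trans (ler_norm_sum _ _ _) _.
apply: ler_sum => i _; rewrite normrM ler_wpM2l //.
apply: le_trans (SM x Sx); rewrite [leRHS]/Num.norm /= mx_normrE.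
exact: (@le_bigmax_cond _ _ _ 0 (i, 0) xpredT (fun ij => `|x ij.1 ij.2|)).
Qed.

End DotProduct.

(** * Geometry of branches and bases *)

Section Feasibility.
Variables (R : realType) (n0 m p q : nat) (L : lpcc R n0 m p q).
Implicit Types (x y z : 'cV[R]_(n0 + (m + m))) (J : label m).

Lemma labels_cover J i : J \in labels m -> (i \in J.1) || (i \in J.2).
Proof. by rewrite inE => /andP[/eqP/setP/(_ i)]; rewrite !inE. Qed.

Lemma active_labelsP x J :
  reflect (J \in labels m /\ branch L J x) (J \in active_labels L x).
Proof. by rewrite [_ \in active_labels _ _]inE; apply: (iffP andP) => -[? /asboolP]. Qed.

Lemma setC_labels (A : {set 'I_m}) : (A, ~: A)%SET \in labels m.
Proof. by rewrite inE /= finset.setUCr finset.setICr !eqxx. Qed.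

Lemma branch_feasible J : J \in labels m -> branch L J `<=` feasible L.
Proof.
move=> JL x [lin b1 b2]; split=> // i.
  by have /orP[/b1[->]|/b2[? ->]] := labels_cover i JL; rewrite lexx.
by have /orP[/b1[->]|/b2[_ ->]] := labels_cover i JL; rewrite ?mul0r ?mulr0.
Qed.

Lemma residual_branch0 J x : branch L J x -> residual J x = 0.
Proof.
by move=> [_ b1 b2]; rewrite /residual !big1 ?addr0 // => i => [/b2[]|/b1[]].
Qed.

(** On the relaxed polyhedron the residual is a sum of nonnegative terms, so it vanishes only if
    each term does. *)
Lemma relaxed_residual0_branch J x :
  relaxed L x -> residual J x = 0 -> branch L J x.
Proof.
move=> [lin ge0] /eqP.
have ge01 i : i \in J.1 -> 0 <= comp1 x i by have [] := ge0 i.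
have ge02 i : i \in J.2 -> 0 <= comp2 x i by have [] := ge0 i.
rewrite /residual paddr_eq0 ?sumr_ge0 // => /andP[s1 s2].
split=> // i iJ; have [x1 x2] := ge0 i; split=> //.
  by move/eqP/psumr_eq0P: s1; exact.
by move/eqP/psumr_eq0P: s2; exact.
Qed.

Lemma drawn_label_active x s :
  feasible L x -> drawn_label x s \in active_labels L x.
Proof.
move=> [lin ge0 compl]; apply/active_labelsP; split; first exact: setC_labels.
split=> //= i; have [x1 x2] := ge0 i.
  by rewrite !inE => /orP[/andP[/eqP]|/andP[/andP[/eqP]]].
(* For an index outside [D1], either [comp1 x i != 0] and complementarity gives [comp2 x i = 0], or
   [comp1 x i = 0] and non-membership in [I0p x] does. *)
rewrite !inE !negb_or => /andP[not0p _]; split=> //.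
have [x10|x1N0] := eqVneq (comp1 x i) 0; last first.
  by move/eqP: (compl i); rewrite mulf_eq0 (negbTE x1N0) => /eqP.
by apply/eqP; move: not0p; rewrite x10 eqxx /= -leNgt eq_le x2 andbT.
Qed.

(* Strictly positive coordinates of [x] stay positive near [x], so a nearby
   feasible point lies in a branch that also contains [x]. *)
Lemma near_feasible_active_branch x : feasible L x ->
  \forall z \near x, feasible L z ->
    exists2 J, J \in active_labels L x & branch L J z.
Proof.
move=> [lin ge0 compl].
have pos j : \forall z \near x, 0 < x j 0 -> 0 < (z : 'cV[R]_(n0 + (m + m))) j 0.
  have [xj|xj] := boolP (0 < x j 0); last first.
    by apply: filterS filterT => z.
  have near_pos : \forall z \near x, 0 < (z : 'cV[R]_(n0 + (m + m))) j 0.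
    exact: (@coord_continuous R _ _ j 0 x _ (lt_nbhsr xj)).
  exact: filterS near_pos.
have := filter_forall (nbhs_filter x) pos.
apply: filterS => z zpos [zlin zge0 zcompl].
(* The label is read off [z] rather than [x]; complementarity puts [z] in its branch. *)
pose A := [set i | comp1 z i == 0]%SET.
have z2 i : i \notin A -> comp2 z i = 0.
  rewrite inE => zN0; move/eqP: (zcompl i).
  by rewrite mulf_eq0 (negbTE zN0) => /eqP.
exists (A, ~: A)%SET; last first.
  split=> //= i; have [? ?] := zge0 i; first by rewrite inE => /eqP.
  by rewrite inE => /z2.
have nonpos (r : R) : 0 <= r -> ~~ (0 < r) -> r = 0.
  by move=> r0; rewrite -leNgt => r0'; apply/eqP; rewrite eq_le r0' r0.
apply/active_labelsP; split; first exact: setC_labels.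
split=> //= i; have [x1 x2] := ge0 i.
  rewrite inE => /eqP z1; split=> //; apply: nonpos => //.
  by apply/negP => /zpos; rewrite -/(comp1 z i) z1 ltxx.
rewrite inE => /z2 {}z2; split=> //; apply: nonpos => //.
by apply/negP => /zpos; rewrite -/(comp2 z i) z2 ltxx.
Qed.

Lemma active_argmin_local_minimizer (f : 'cV[R]_(n0 + (m + m)) -> R) x :
  feasible L x ->
  (forall J, J \in active_labels L x -> argmin (branch L J) f x) ->
  local_minimizer f (feasible L) x.
Proof.
move=> xF opt; split=> //.
have := near_feasible_active_branch xF.
apply: filterS => z zJ /zJ[J /opt[_ le_f]].
exact: le_f.
Qed.

(** As many independent tight rows as variables form a matrix with a left inverse [B], which
    recovers the point from the right-hand sides. *)
Lemma feasible_basis_inj S x y :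
  feasible_basis L S x -> feasible_basis L S y -> x = y.
Proof.
move=> [_ cardS free tight_x] [_ _ _ tight_y].
have : row_full (rowsub (enum_val : 'I_#|S| -> _) (all_mx L)).
  by rewrite /row_full (eqP free) cardS.
move=> /row_fullP[B BA].
rewrite -[x]mul1mx -[y]mul1mx -BA -!mulmxA; congr (_ *m _).
apply/colP => i; rewrite !mul_rowsub_mx !mxE.
have iS := enum_valP i.
by have := tight_x _ iS; have := tight_y _ iS; rewrite !mxE => -> ->.
Qed.

End Feasibility.

(** * Descent and termination along a single realization *)

Section Algorithm.
Variables (R : realType) (n0 m p q : nat) (L : lpcc R n0 m p q).
Variables (c : 'cV[R]_(n0 + (m + m))) (rho : R).
Implicit Types (J : label m) (u v : state R n0 m p q).

(** The loop invariant: feasibility makes every drawn label active, and the basis encodes the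
    iterate by finite data. *)
Let valid u := feasible L u.2 /\ feasible_basis L u.1 u.2.

Lemma rpsa_init_valid xin u :
  feasible L xin -> rpsa_init L c xin u -> valid u.
Proof.
move=> xinF [ext not_ext u_basis]; split=> //.
have [/ext-> //|/not_ext] := pselect (extreme_points (relaxed L) xin).
by move=> [J /active_labelsP[JL _]] [_ [uJ _]]; exact: branch_feasible uJ.
Qed.

(** Both residuals vanish, so the penalized values compared by [acceptable] are plain costs. *)
Lemma acceptable_descent J x z :
  branch L J x -> relaxed L z -> acceptable c rho J x z ->
  branch L J z /\ dot c z < dot c x.
Proof.
move=> xJ zC /andP[decr /eqP z0]; split; first exact: relaxed_residual0_branch.
by move: decr; rewrite /penalized z0 (residual_branch0 xJ) !mulr0 !addr0.
Qed.

Lemma rpsa_step_descent J u v :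
  valid u -> J \in active_labels L u.2 -> rpsa_step L c rho J u v ->
  valid v /\ (v = u \/ dot c v.2 < dot c u.2).
Proof.
move=> u_valid /active_labelsP[JL uJ] [s [_ run _]] v_head.
(* With no acceptable vertex, [head] returns its default [u]. *)
case E : [seq w <- u :: s | acceptable c rho J u.2 w.2] => [|w t] in v_head.
  by rewrite v_head; split=> //; left.
have : w \in [seq w <- u :: s | acceptable c rho J u.2 w.2].
  by rewrite E mem_head.
rewrite mem_filter v_head => /andP[acc /run[_ w_basis]].
have wC : relaxed L w.2 by case: w_basis.
have [wJ descent] := acceptable_descent uJ wC acc.
by split; [split=> //; exact: branch_feasible wJ|right].
Qed.

(* A penalty-LP optimum with lower cost on the branch of [J] is acceptable, so
   the iterate can only survive the draw of [J] if it is optimal there. *)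
Lemma rpsa_step_stay_argmin J u v :
  argmin (relaxed L) (penalized c rho J) = argmin (branch L J) (dot c) ->
  branch L J u.2 -> rpsa_step L c rho J u v -> v.2 = u.2 ->
  argmin (branch L J) (dot c) u.2.
Proof.
move=> exact uJ [s [_ _ last_opt] v_head] v2.
move: last_opt; rewrite exact => -[zJ z_opt].
have [le_uz|lt_zu] := leP (dot c u.2) (dot c (last u s).2).
  by split=> // y /z_opt; exact: le_trans.
have acc : acceptable c rho J u.2 (last u s).2.
  rewrite /acceptable /penalized (residual_branch0 zJ) (residual_branch0 uJ).
  by rewrite !mulr0 !addr0 lt_zu eqxx.
have : last u s \in [seq w <- u :: s | acceptable c rho J u.2 w.2].
  by rewrite mem_filter acc mem_last.
case E : [seq w <- u :: s | acceptable c rho J u.2 w.2] => [//|w t] _.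
have : w \in [seq w <- u :: s | acceptable c rho J u.2 w.2].
  by rewrite E mem_head.
(* The first acceptable vertex [w] is the new state, so [v.2 = u.2] would make its penalized value
   smaller than itself. *)
rewrite mem_filter => /andP[/andP[lt_wu _] _].
by move: lt_wu; rewrite -v2 v_head E ltxx.
Qed.

Variables (xin : 'cV[R]_(n0 + (m + m))) (st : nat -> state R n0 m p q).
Variable xi : nat -> {ffun 'I_m -> bool}.
Hypothesis xin_feasible : feasible L xin.
Hypothesis realization : rpsa_realization L c rho xin st xi.

Lemma rpsa_valid k : valid (st k).
Proof.
elim: k => [|k IHk]; first exact: rpsa_init_valid realization.1.
have active := drawn_label_active (xi k) IHk.1.
by have [] := rpsa_step_descent IHk active (realization.2 k).
Qed.

Lemma rpsa_descent k :
  st k.+1 = st k \/ dot c (st k.+1).2 < dot c (st k).2.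
Proof.
have k_valid := rpsa_valid k.
have active := drawn_label_active (xi k) k_valid.1.
by have [] := rpsa_step_descent k_valid active (realization.2 k).
Qed.

(* The number of bases representing a point of lower cost than the iterate
   drops whenever the iterate changes. *)
Lemma rpsa_eventually_constant :
  exists N, forall k, (N <= k)%N -> (st k).2 = (st N).2.
Proof.
pose lower k := [set S : basis_set m p q |
  `[< exists2 x, feasible_basis L S x & dot c x < dot c (st k).2 >]]%SET.
have lower_decr k :
    dot c (st k.+1).2 < dot c (st k).2 -> (#|lower k.+1| < #|lower k|)%N.
  move=> descent; apply: proper_card; apply/properP; split.
    apply/fintype.subsetP => S; rewrite !inE => -[x xS x_lt].
    by exists x => //; exact: lt_trans descent.
  have [_ basis] := rpsa_valid k.+1.
  (* The basis of the new iterate is counted at [k] but not at [k.+1], since it represents no other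
     point. *)
  exists (st k.+1).1; first by rewrite !inE; exists (st k.+1).2.
  rewrite inE; apply/asboolP => -[x x_basis].
  by rewrite (feasible_basis_inj x_basis basis) ltxx.
(* [N] is chosen to minimize the count, so no strict descent can follow it. *)
have card_attained : exists n, `[< exists k, #|lower k| = n >].
  by exists #|lower 0|; apply/asboolP; exists 0%N.
have [n /asboolP[N N_card] n_min] := ex_minnP card_attained.
exists N; elim=> [|k IHk]; first by rewrite leqn0 => /eqP->.
rewrite leq_eqVlt => /orP[/eqP<- //|/IHk {IHk}stk].
have [-> //|/lower_decr] := rpsa_descent k.
rewrite {2}/lower stk -/(lower N) N_card ltnNge n_min //.
by apply/asboolP; exists k.+1.
Qed.

End Algorithm.

(** * Repeated trials with a fixed conditional success probability *)

Section NeverDrawn.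
Context {R : realType} {d : measure_display} {Xi : measurableType d}.
Variable P : probability Xi R.

(** Presents a set-level sigma-algebra as the measurable sets of a type, so that the closure lemmas
    for measurable sets apply to each [F k]. *)
Lemma sigma_algebra_measurable (T : pointedType) (G : set (set T)) :
  sigma_algebra setT G ->
  G = (measurable : set (set (g_sigma_algebraType G))).
Proof. by move=> sG; rewrite /measurable /= sigma_algebra_id. Qed.

Lemma measurable_wrt_col_eq n (G : set (set Xi)) (x : Xi -> 'cV[R]_n) y :
  sigma_algebra setT G ->
  (forall i, measurable_wrt G (fun w => x w i 0)) ->
  G [set w | x w = y].
Proof.
move=> sG xG.
have -> : [set w | x w = y] =
    \bigcap_(i in [set: 'I_n]) (fun w => x w i 0) @^-1` [set y i 0].
  apply/seteqP; split=> [w xw i _|w xy]; first by rewrite /= xw.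
  by apply/colP => i; exact: xy.
rewrite (sigma_algebra_measurable sG); apply: fin_bigcap_measurable => // i _.
by rewrite -sigma_algebra_measurable //; exact: xG.
Qed.

(** The integral of the version [g] over [A], which defines the left-hand side, is that of a
    constant. *)
Lemma is_cond_prob_cst (G : set (set Xi)) E g A (r : R) :
  is_cond_prob P G E g -> measurable A -> G A -> (forall w, A w -> g w = r) ->
  P (A `&` E) = (r%:E * P A)%E.
Proof.
move=> [_ intg] mA GA gr; rewrite -(intg _ GA) -integral_cst //.
by apply: eq_integral => w /set_mem /gr ->.
Qed.

Lemma negligible_bigcup_countType (I : countType) (A : I -> set Xi) :
  (forall i, P.-negligible (A i)) -> P.-negligible (\bigcup_i A i).
Proof.
move=> negl.
apply: negligibleS (_ : P.-negligible
  (\bigcup_k if unpickle k is Some i then A i else set0)).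
  by move=> w [i _ Aiw]; exists (pickle i) => //; rewrite pickleK.
apply: negligible_bigcup => k; case: unpickle => [i|]; first exact: negl.
exact: negligible_set0.
Qed.

(* Each further trial multiplies the probability of having stayed in [X]
   without a success by at most [1 - r]. *)
Lemma never_drawn_negligible (F : nat -> set (set Xi)) (X D : nat -> set Xi)
    (r : R) (N : nat) :
  filtration F -> 0 < r <= 1 ->
  (forall k, F k (X k)) -> (forall k, F k.+1 (D k)) ->
  (forall k A, F k A -> A `<=` X k -> P (A `&` D k) = (r%:E * P A)%E) ->
  P.-negligible [set w | forall k, (N <= k)%N -> X k w /\ ~ D k w].
Proof.
move=> filt /andP[r_gt0 r_le1] FX FD PD.
have sF k : sigma_algebra setT (F k) by case: (filt k).
have mF k : F k `<=` measurable by case: (filt k).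
have FS k : F k `<=` F k.+1 by case: (filt k).
have FI k A B : F k A -> F k B -> F k (A `&` B).
  by rewrite (sigma_algebra_measurable (sF k)); exact: measurableI.
have FdiffD k A B : F k A -> F k B -> F k (A `\` B).
  by rewrite (sigma_algebra_measurable (sF k)); exact: measurableD.
(* [B j] is the event that the [j] trials from time [N] on all took place in [X] and all failed. It
   is known at time [N + j], which allows conditioning the next trial on it. *)
pose B := fix B j := if j is j'.+1
  then (B j' `&` X (N + j')%N) `\` D (N + j')%N else setT.
have FB j : F (N + j)%N (B j).
  elim: j => [|j IHj] /=.
    by rewrite (sigma_algebra_measurable (sF _)); exact: measurableT.
  by rewrite addnS; apply: FdiffD => //; exact/FS/FI.
have mB j : measurable (B j) by exact: mF (FB j).
have PB j : (P (B j) <= ((1 - r) ^+ j)%:E)%E.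
  elim: j => [|j IHj]; first by rewrite expr0 probability_le1.
  set A := B j `&` X (N + j)%N.
  have FA : F (N + j)%N A by exact: FI.
  have mA : measurable A by exact: mF FA.
  have mD : measurable (D (N + j)%N) by exact: mF (FD _).
  have : P A = (P (A `\` D (N + j)%N) + P (A `&` D (N + j)%N))%E.
    exact: measureDI.
  have PA_le : (P A <= P (B j))%E.
    by apply: le_measure; rewrite ?inE //; exact: subIsetl.
  rewrite PD //; last exact: subIsetr.
  move: (le_trans PA_le IHj).
  rewrite [B j.+1]/= -/A.
  (* All these probabilities are finite, so the splitting of [P A] is moved to [R], where
     subtraction is available. *)
  rewrite -[P A]fineK ?fin_num_measure // -[P (A `\` _)]fineK; last first.
    by rewrite fin_num_measure //; exact: measurableD.
  rewrite -EFinM -EFinD !lee_fin => PA_le' [PAE].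
  have -> : fine (P (A `\` D (N + j)%N)) = (1 - r) * fine (P A).
    by rewrite mulrBl mul1r [X in X - _]PAE addrK.
  by rewrite exprS ler_wpM2l // subr_ge0.
have mcapB : measurable (\bigcap_j B j) by exact: bigcapT_measurable.
apply: (@negligibleS _ _ _ _ (\bigcap_j B j)).
  move=> w never j _; elim: j => //= j IHj.
  by have [] := never (N + j)%N (leq_addr _ _).
apply/negligibleP => //; apply/eqP; rewrite eq_le measure_ge0 andbT.
rewrite -[X in (X <= _)%E]fineK ?fin_num_measure // lee_fin.
(* The intersection has probability at most [(1 - r) ^+ j] for every [j], and [0 <= 1 - r < 1]. *)
have pow_cvg : (1 - r) ^+ j @[j --> \oo] --> (0 : R).
  by apply: cvg_expr; rewrite ger0_norm ?subr_ge0 // ltrBlDr ltrDl.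
have /cvg_lim <- // := pow_cvg.
apply: limr_ge; first by apply/cvg_ex; exists 0.
apply: nearW => j; rewrite -lee_fin fineK ?fin_num_measure //.
apply: le_trans (PB j); apply: le_measure; rewrite ?inE //.
by apply: bigcap_inf.
Qed.

End NeverDrawn.

Theorem theorem2 (R : realType) (n0 m p q : nat) (m_gt0 : (0 < m)%N)
    (L : lpcc R n0 m p q) (c : 'cV[R]_(n0 + (m + m)))
    (Omega_bounded : bounded_set (feasible L))
    (rhoJ : label m -> R)
    (rhoJ_exact : forall J, J \in labels m -> branch L J !=set0 ->
       has_lbound (dot c @` branch L J) -> exact_threshold L c J (rhoJ J))
    (rho : R) (rho_large : max_threshold L rhoJ < rho)
    (xin : 'cV[R]_(n0 + (m + m))) (xin_feasible : feasible L xin)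
    (d : measure_display) (Xi : measurableType d) (P : probability Xi R)
    (F : nat -> set (set Xi))
    (st : nat -> Xi -> state R n0 m p q)
    (xi : nat -> Xi -> {ffun 'I_m -> bool})
    (realizations : forall w,
       rpsa_realization L c rho xin (fun k => st k w) (fun k => xi k w))
    (sampling : rpsa_sampling P L F (fun k w => (st k w).2) xi) :
  (forall w, exists N, forall k, (N <= k)%N -> (st k w).2 = (st N w).2) /\
  forall N : Xi -> nat,
    (forall w k, (N w <= k)%N -> (st k w).2 = (st (N w) w).2) ->
    {ae P, forall w,
       B_stationary (dot c) (feasible L) (st (N w) w).2 /\
       local_minimizer (dot c) (feasible L) (st (N w) w).2}.
Proof.
split=> [w|N N_final].
  exact: rpsa_eventually_constant xin_feasible (realizations w).
have valid k w := rpsa_valid xin_feasible (realizations w) k.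
(* An active branch is nonempty, and boundedness of the feasible set bounds the cost below on it, so
   its threshold is exact and lies below [rho]. *)
have exact_penalty J x : J \in active_labels L x ->
    argmin (relaxed L) (penalized c rho J) = argmin (branch L J) (dot c).
  move=> /active_labelsP[JL xJ].
  have J_nonempty : branch L J !=set0 by exists x.
  apply: (rhoJ_exact J JL J_nonempty _).2.
    have [M lbM] := bounded_set_dot_lbound c Omega_bounded.
    exists M => _ [y yJ <-]; apply: lbM; exists y => //.
    exact: branch_feasible yJ.
  apply: le_lt_trans rho_large.
  by apply: le_bigmax_cond; rewrite JL; exact/asboolP.
(* The default [0] is harmless: [vertex] is identified with an iterate only at a stored basis, which
   does represent a point. *)
pose vertex S := xget 0 [set x | feasible_basis L S x].
(* The settled point, the missed label and the settling time are all random. Fixing a basis, a label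
   and a time splits the bad event into countably many events with a deterministic point. *)
pose never (i : basis_set m p q * label m * nat) := [set w |
  i.1.2 \in active_labels L (vertex i.1.1) /\ forall k, (i.2 <= k)%N ->
    (st k w).2 = vertex i.1.1 /\ drawn_label (st k w).2 (xi k w) <> i.1.2].
have never_negligible i : P.-negligible (never i).
  case: i => [[S J] N0].
  have [JS|JS] := boolP (J \in active_labels L (vertex S)); last first.
    by apply: (negligibleS _ (negligible_set0 P)) => w [/= JS' _]; case/negP: JS.
  (* The conditional probability of drawing [J] whenever the iterate is [vertex S]. *)
  pose r : R := #|active_labels L (vertex S)|%:R^-1.
  have card_gt0 : (0 < #|active_labels L (vertex S)|)%N.
    by apply/card_gt0P; exists J.
  apply: (negligibleS _ (@never_drawn_negligible R d Xi P F
    (fun k => [set w | (st k w).2 = vertex S])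
    (fun k => [set w | drawn_label (st k w).2 (xi k w) = J]) r N0 _ _ _ _ _)).
  - by move=> w [].
  - exact: sampling_filtration sampling.
  - by rewrite invr_gt0 ltr0n card_gt0 invf_le1 ?ltr0n // ler1n.
  - move=> k; apply: measurable_wrt_col_eq.
      by case: (sampling_filtration sampling k).
    by move=> i; exact: (iterate_measurable sampling k i).
  - by move=> k; exact: (label_measurable sampling k J).
  - move=> k A FA AX; have [JL _] := active_labelsP _ _ _ JS.
    have [_ mF _] := sampling_filtration sampling k.
    apply: (is_cond_prob_cst (label_law sampling k JL)) => //; first exact: mF.
    by move=> w /AX /= ->; rewrite JS mul1r.
apply: negligibleS (negligible_bigcup_countType never_negligible) => w bad.
have [xF x_basis] := valid (N w) w.
have vertexE : vertex (st (N w) w).1 = (st (N w) w).2.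
  rewrite /vertex; case: xgetP => [y -> /= y_basis|/(_ (st (N w) w).2) //].
  exact: feasible_basis_inj y_basis x_basis.
apply: contrapT => not_never; apply: bad.
suff local_min : local_minimizer (dot c) (feasible L) (st (N w) w).2.
  by split=> //; exact: local_minimizer_dot_B_stationary.
apply: active_argmin_local_minimizer => // J J_active.
apply: contrapT => not_opt; apply: not_never.
(* If the settled point is not optimal on [J], then drawing [J] after [N w] is impossible: the
   iterate stays put, which would force optimality. *)
exists ((st (N w) w).1, J, N w) => //; split; rewrite /= vertexE // => k Nk.
split=> [|drawn]; first exact: N_final.
apply: not_opt; rewrite -(N_final w k Nk).
have stay : (st k.+1 w).2 = (st k w).2.
  by rewrite !N_final // (leq_trans Nk).
have step := (realizations w).2 k; rewrite drawn in step.
apply: rpsa_step_stay_argmin step stay; first exact: exact_penalty J_active.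
by rewrite N_final //; have [] := active_labelsP _ _ _ J_active.
Qed.
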